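(* Let $f$ be a Schur positive homogeneous symmetric function, and let $\lambda^1,\lambda^2,\dots,\lambda^k$ be any sequence of partitions of two (that is, each $\lambda^i\in\{(2),(1,1)\}$). If $f$ is flip-symmetric with offset $r$, then $$s_{\lambda^1}\circ s_{\lambda^2}\circ\cdots\circ s_{\lambda^k}\circ f$$ is also flip-symmetric, with offset $2^kr-2^{k+1}+2$.
   Context: Let $\Lambda=\mathbb{Q}[p_1,p_2,\dots]$ be the algebra of symmetric functions, with power sums $p_k$ and Schur functions $s_\lambda$. A symmetric function is Schur positive if its coefficients in the Schur basis are non-negative integers. The plethysm $\circ$ is determined by: $p_n\circ p_m=p_{nm}$; for each $f\in\Lambda$ the map $g\mapsto g\circ f$ is an algebra homomorphism; and $p_n\circ f=f\circ p_n$ (so $p_n\circ f$ is obtained from $f$ by replacing each $p_m$ by $p_{nm}$). Plethysm is associative. A partition is a hook+column partition if it is of the form $(\alpha,2^\beta,1^\gamma)$, where $\alpha$ is the first part (possibly equal to $1$ or $2$), followed by $\beta$ parts equal to $2$ and $\gamma$ parts equal to $1$. Flip involution: let $r\ge 2$ be an integer and $\lambda=(\lambda_1,2^\beta,1^\gamma)$ a hook+column partition such that $\lambda_1-r-\gamma=2\delta$ for some non-negative integer $\delta$. Then the flip with offset $r$ is defined on $\lambda=(r+2\delta+\gamma,2^\beta,1^\gamma)$ by $\mathrm{flip}(r;\lambda)=(r+2\beta+\gamma,2^\delta,1^\gamma)$. It is not defined on other partitions. Write $[\mu]f$ for the coefficient of $s_\mu$ in the Schur expansion of $f$, and $\mathrm{supp}(f)=\{\mu:[\mu]f\neq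 0\}$. A symmetric function $f$ is flip-symmetric with offset $r$ (where $r\ge2$) if for every hook+column partition $\mu\in\mathrm{supp}(f)$: (1) $\mathrm{flip}(r;-)$ is defined on $\mu$, and (2) $[\mu]f=[\mathrm{flip}(r;\mu)]f$. *)

(* Defs.v *)
From Stdlib Require Import ClassicalEpsilon.
From HB Require Import structures.
From mathcomp Require Export all_boot all_order all_algebra finmap.
From mathcomp Require Export monalg.

Set Implicit Arguments.
Unset Strict Implicit.
Unset Printing Implicit Defensive.

Import GRing.Theory Num.Theory.
Local Open Scope ring_scope.

(** * The algebra QQ[p_1, p_2, ...] *)

(* The polynomial variable of index [i : nat] is the power sum p_{i+1}, so
   that no spurious variable p_0 is present. *)
Notation symfun := {malg rat[{cmonom nat}]}.

(* Meaningful for [0 < n]. *)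
HB.lock Definition psum (n : nat) : symfun := << ucm n.-1 >>.

(* p_k has degree k. *)
Definition weight (m : {cmonom nat}) : nat :=
  (\sum_(i <- finsupp m) i.+1 * m i)%N.

Definition homogeneous (f : symfun) : Prop :=
  exists d : nat, {in msupp f, forall m, weight m = d}.

(* The image of a monomial under p_{i+1} |-> x i. *)
Definition pmonom (x : nat -> symfun) (m : {cmonom nat}) : symfun :=
  \prod_(i <- finsupp m) x i ^+ m i.

(* The algebra endomorphism p_{i+1} |-> x i. *)
Definition psubst (x : nat -> symfun) (g : symfun) : symfun :=
  mmap (@malgC {cmonom nat} rat) (pmonom x) g.

Section PsubstTheory.
Variable x : nat -> symfun.

Lemma pmonomE (E : {fset nat}) (m : {cmonom nat}) :
  (finsupp m `<=` E)%fset -> pmonom x m = \prod_(i <- E) x i ^+ m i.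
Proof.
move=> sE; rewrite /pmonom (big_fset_incl _ sE) // => i _.
by rewrite -cmE_eq0 => /eqP ->; rewrite expr0.
Qed.

Lemma pmonom_mmorphism : mmorphism (pmonom x).
Proof.
split=> [m1 m2|]; last by rewrite /pmonom mdom1 big_seq_fset0.
pose E := (finsupp m1 `|` finsupp m2)%fset.
rewrite (@pmonomE E) ?(@pmonomE E m1) ?(@pmonomE E m2) ?fsubsetUl ?fsubsetUr //.
  by rewrite -big_split; apply: eq_bigr => i _; rewrite cmM exprD.
by rewrite mdomD.
Qed.

HB.instance Definition _ :=
  isMultiplicative.Build {cmonom nat} symfun (pmonom x) pmonom_mmorphism.
HB.instance Definition _ :=
  GRing.RMorphism.copy (psubst x) (mmap (@malgC {cmonom nat} rat) (pmonom x)).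

Lemma psubstZ c g : psubst x (c *: g) = c *: psubst x g.
Proof. by rewrite /psubst (mmapZ (f := malgC) (h := (pmonom x))) mul_malgC. Qed.

Lemma psubst_psum n : (0 < n)%N -> psubst x (psum n) = x n.-1.
Proof.
move=> n0; rewrite /psubst psum.unlock (mmapU (f := malgC)) /=.
rewrite /pmonom mdomU big_seq_fset1 cmUU expr1.
by rewrite (rmorph1 malgC) mul1r.
Qed.
End PsubstTheory.

(** * Plethysm *)

(* p_n o f, obtained from f by replacing each p_m by p_{nm}. *)
Definition adams (n : nat) (f : symfun) : symfun :=
  psubst (fun i => psum (n * i.+1)) f.

(* g o f, the image of g under the algebra morphism p_n |-> p_n o f. *)
Definition plethysm (g f : symfun) : symfun :=
  psubst (fun i => adams i.+1 f) g.

Lemma adams_psum n m : (0 < m)%N -> adams n (psum m) = psum (n * m).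
Proof. by move=> m0; rewrite /adams (psubst_psum _ m0) prednK. Qed.

Lemma plethysm_psum n f : (0 < n)%N -> plethysm (psum n) f = adams n f.
Proof. by move=> n0; rewrite /plethysm (psubst_psum _ n0) prednK. Qed.

Lemma plethysmD g1 g2 f :
  plethysm (g1 + g2) f = plethysm g1 f + plethysm g2 f.
Proof. exact: (rmorphD (psubst _)). Qed.

Lemma plethysmM g1 g2 f :
  plethysm (g1 * g2) f = plethysm g1 f * plethysm g2 f.
Proof. exact: (rmorphM (psubst _)). Qed.

Lemma plethysm1 f : plethysm 1 f = 1.
Proof. exact: (rmorph1 (psubst _)). Qed.

Lemma plethysmZ c g f : plethysm (c *: g) f = c *: plethysm g f.
Proof. exact: psubstZ. Qed.

(** * Partitions and Schur functions *)

Definition is_part (s : seq nat) : bool := sorted geq s && (0 \notin s)%N.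

Record intpart : predArgType :=
  IntPart { parts :> seq nat; _ : is_part parts }.
HB.instance Definition _ := [isSub for parts].
HB.instance Definition _ := [Choice of intpart by <:].

(* The sequence [:: h_0; ...; h_n] of complete homogeneous symmetric functions,
   given by Newton's identities n h_n = \sum_(1 <= k <= n) p_k h_{n-k}. *)
Fixpoint hsums (n : nat) : seq symfun :=
  if n is m.+1 then
    let s := hsums m in
    rcons s (m.+1%:R^-1 *: \sum_(k < m.+1) psum k.+1 * s`_(m - k))
  else [:: 1].

HB.lock Definition hsum (n : nat) : symfun := (hsums n)`_n.

Lemma size_hsums n : size (hsums n) = n.+1.
Proof. by elim: n => //= n IH; rewrite size_rcons IH. Qed.

Lemma nth_hsums n k : (k <= n)%N -> (hsums n)`_k = hsum k.
Proof.
elim: n => [|n IH]; first by case: k => // _; rewrite hsum.unlock.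
rewrite leq_eqVlt => /orP[/eqP -> |kn]; first by rewrite hsum.unlock.
by rewrite [hsums _]/= nth_rcons size_hsums kn IH.
Qed.

Lemma hsum0 : hsum 0 = 1. Proof. by rewrite hsum.unlock. Qed.

Lemma hsumS n :
  n.+1%:R *: hsum n.+1 = \sum_(k < n.+1) psum k.+1 * hsum (n - k).
Proof.
rewrite {1}hsum.unlock [hsums _]/= nth_rcons size_hsums ltnn eqxx scalerA.
rewrite divff ?pnatr_eq0 // scale1r.
by apply: eq_bigr => k _; rewrite nth_hsums ?leq_subr.
Qed.

Lemma hsum1 : hsum 1 = psum 1.
Proof. by have := hsumS 0; rewrite scale1r big_ord1 hsum0 mulr1. Qed.

Lemma hsum2 : hsum 2 = 2^-1 *: (psum 1 ^+ 2 + psum 2).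
Proof.
have := congr1 (GRing.scale 2^-1) (hsumS 1).
rewrite scalerA (mulVf (x := 2%:R :> rat) isT) scale1r => ->.
by rewrite big_ord_recl big_ord1 /= hsum1 hsum0 mulr1 expr2.
Qed.

(* Jacobi-Trudi: s_la = det (h_{la_i - i + j}), where h_n = 0 for n < 0. *)
Definition schur (la : intpart) : symfun :=
  \det (\matrix_(i < size la, j < size la)
          if (i <= nth 0%N la i + j)%N then hsum (nth 0%N la i + j - i) else 0).

Lemma schur_2 (la : intpart) :
  parts la = [:: 2] -> schur la = 2^-1 *: (psum 1 ^+ 2 + psum 2).
Proof. by case: la => s p /= e; subst s; rewrite /schur det_mx11 !mxE hsum2. Qed.

Lemma schur_11 (la : intpart) :
  parts la = [:: 1; 1] -> schur la = 2^-1 *: (psum 1 ^+ 2 - psum 2).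
Proof.
case: la => s p /= e; subst s; rewrite /schur.
rewrite (expand_det_row _ ord0) big_ord_recl big_ord1 /cofactor !det_mx11 !mxE /=.
rewrite !addn0 !addn1 !subn0 expr0 expr1 !mul1r mulN1r mulrN.
rewrite subnn hsum0 hsum1 hsum2 mulr1; set a := psum 1; set b := psum 2.
have -> : a * a = 2^-1 *: (a ^+ 2 *+ 2).
  by rewrite -scaler_nat scalerA (mulVf (x := 2%:R :> rat) isT) scale1r.
by rewrite -scalerBr mulr2n opprD addrACA subrr add0r.
Qed.

(* [c] gathers the coefficients of an expansion of [f] in Schur functions. *)
Definition schur_expansion (f : symfun) (c : {malg rat[intpart]}) : Prop :=
  f = \sum_(mu <- msupp c) c@_mu *: schur mu.

(* [mu]f.  As the Schur functions form a basis, the expansion selected here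
   exists and is unique. *)
Definition schur_coef (mu : intpart) (f : symfun) : rat :=
  (epsilon (inhabits 0) (schur_expansion f))@_mu.

Definition schur_positive (f : symfun) : Prop :=
  forall mu : intpart, schur_coef mu f \is a Num.nat.

(** * Flip symmetry *)

(* (a, 2^b, 1^c) *)
Definition hook_col (a b c : nat) : seq nat := a :: nseq b 2%N ++ nseq c 1%N.

Definition is_hook_col (mu : intpart) : Prop :=
  exists a b c : nat, parts mu = hook_col a b c.

(* The graph of the partial map flip(r; -): it is defined on [mu] when some
   [nu] satisfies [flip r mu nu]. *)
Definition flip (r : nat) (mu nu : intpart) : Prop :=
  exists b c d : nat,
    parts mu = hook_col (r + 2 * d + c) b c /\
    parts nu = hook_col (r + 2 * b + c) d c.

Definition flip_symmetric (r : nat) (f : symfun) : Prop :=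
  (2 <= r)%N /\
  forall mu : intpart, is_hook_col mu -> schur_coef mu f != 0 ->
    exists2 nu, flip r mu nu & schur_coef mu f = schur_coef nu f.

Lemma hook_col_inj a b c a' b' c' :
  hook_col a b c = hook_col a' b' c' -> [/\ a = a', b = b' & c = c'].
Proof.
case=> -> e; split=> //; [have := congr1 (count_mem 2) e | have := congr1 (count_mem 1) e];
  by rewrite !count_cat !count_nseq !mul1n !mul0n ?addn0.
Qed.

Lemma flip_functional r mu nu nu' : flip r mu nu -> flip r mu nu' -> nu = nu'.
Proof.
move=> [b [c [d [e1 e2]]]] [b' [c' [d' [e1' e2']]]].
have [h hb hc] := hook_col_inj (etrans (esym e1) e1').
apply: val_inj; rewrite /= e2 e2' -hb -hc; congr hook_col.
move: h; rewrite -hc => /addIn /addnI /eqP.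
by rewrite eqn_mul2l => /eqP.
Qed.

Lemma flip_defined r a b c (mu : intpart) :
  (2 <= r)%N -> parts mu = hook_col a b c ->
  (exists nu, flip r mu nu) <-> exists d, a = (r + 2 * d + c)%N.
Proof.
move=> r2 e; split=> [[nu [b' [c' [d [e' _]]]]] | [d ad]].
  by have [-> _ ->] := hook_col_inj (etrans (esym e) e'); exists d.
have p : is_part (hook_col (r + 2 * b + c) d c).
  have r0 : (2 <= r + 2 * b + c)%N by rewrite -addnA (leq_trans r2) ?leq_addr.
  apply/andP; split; last first.
    by rewrite inE mem_cat !mem_nseq !andbF !orbF; case: (_ + c)%N r0.
  have p1 x : (0 < x)%N -> path geq x (nseq c 1%N).
    by elim: c {e ad r0} x => //= n IH x x0; rewrite x0 IH.
  rewrite /=; elim: d {ad} (r + _ + _)%N r0 => [|n IH] x x2 /=.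
    by apply: p1; apply: leq_trans x2.
  by rewrite x2 IH.
by exists (IntPart p), b, c, d; rewrite e ad.
Qed.

(* Main.v *)
From HB Require Import structures.
Require Import Defs.
From mathcomp Require Import fingroup perm ring zify.

Set Implicit Arguments.
Unset Strict Implicit.
Unset Printing Implicit Defensive.

Import Order.TTheory GRing.Theory Num.Theory.
Local Open Scope ring_scope.

(** Hook+column partitions are the partitions whose Schur function survives
    in one even variable x and two odd variables y1, y2, that is, under the
    specialisation p_n |-> x^n - (-y1)^n - (-y2)^n, called [ev x y1 y2] below.
    With mu = (a, 2^b, 1^c) and a >= 2 the value factors ([ev_schur]) as
      x^(a-2) (x + y1) (x + y2) (y1 y2)^b h_c(y1, y2),
    a column 1^n goes to h_n(y1, y2) + x h_(n-1)(y1, y2), and everything else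
    except the empty partition goes to 0.

    Substitute y1 = s t and y2 = s / t.  The factor (x + y1)(x + y2) becomes
    symmetric in x and s, and the rest becomes x^(a-2) s^(2b+c) h_c(t, 1/t).
    When a = r + 2d + c, this is x^(r-2) times x^(2d+c) s^(2b+c) h_c(t, 1/t),
    so exchanging b and d amounts to exchanging x and s in the last product.
    Hence flip symmetry of g with offset r says that the specialisation of g,
    divided by x^(r-2), is symmetric in x and s, together with its vanishing at
    x = -y1, which excludes columns from the support
    ([flip_invariant_of_flip_symmetric], [flip_symmetric_of_invariant]).

    This description is stable under plethysm with a partition of two:
    s_la o g = (g^2 +- p_2 o g) / 2, and applying p_2 on the left of g turns
    the point (x, y1, y2) into (x^2, -y1^2, -y2^2).  Both g^2 and p_2 o g are
    x^(2(r-2)) times something symmetric; for the second term the sign in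
    -y_i^2 is absorbed because all degrees in play have the parity of r.  So
    the offset goes from r to 2(r - 2) + 2 ([flip_invariant_plethysm]).

    The coefficients [schur_coef] mean something only for symmetric functions
    that have a Schur expansion.  Every symmetric function has one
    ([schur_spanned_all]): expanding the Jacobi-Trudi determinant, every
    permutation other than the identity produces a product of h_n with a larger
    sum of squares of indices, so the products of h_n are reached by a
    triangular elimination.

    A nonzero constant term is the one obstacle to the vanishing at x = -y1.
    For homogeneous f it forces f to be a constant, and then all iterated
    plethysms are constants, whose support contains no hook. *)

(** * Evaluation of symmetric functions *)

Lemma monomialE (c : rat) (m : {cmonom nat}) :
  << c *g m >> = c *: << m >> :> symfun.
Proof. by rewrite -[RHS]mul_malgC malgM_def fgmulUU mulr1 mul1m. Qed.

(** Induction along a monomial, removing one power sum at a time. *)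
Lemma symfun_ind (P : symfun -> Prop) :
  P 1 -> (forall n g, P g -> P (psum n.+1 * g)) ->
  (forall g1 g2, P g1 -> P g2 -> P (g1 + g2)) ->
  (forall c g, P g -> P (c *: g)) -> forall g, P g.
Proof.
move=> P1 PM PD PZ.
have P0 : P 0 by rewrite -(scale0r 1); apply: PZ.
have Pm d (m : {cmonom nat}) : mdeg m = d -> P << m >>.
  elim: d m => [|d IH] m dm; first by rewrite (mdeg_eq0I dm).
  have [m0|] := boolP (finsupp m == fset0).
    have /eqP e : mdeg m == 0%N by rewrite mdegE (eqP m0) big_seq_fset0.
    by exfalso; rewrite e in dm.
  case/fset0Pn => i; rewrite -cmE_neq0 => mi.
  have em : m = mmul (ucm i) (divcm m (ucm i)).
    apply/eqP/cmP => j; rewrite cmM divcmE cmU.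
    by case: eqP => [<-|_]; lia.
  have -> : << m >> = psum i.+1 * << divcm m (ucm i) >> :> symfun.
    by rewrite psum.unlock /= {1}em malgM_def fgmulUU mul1r.
  apply: PM; apply: IH; move: dm; rewrite {1}em mdegM mdegU; lia.
move=> g; rewrite (monalgE g); elim/big_rec: _ => // m h _ Ph.
apply: (PD _ _ _ Ph).
rewrite monomialE.
exact/PZ/(Pm (mdeg m)).
Qed.

Lemma psubstD w (g1 g2 : symfun) : psubst w (g1 + g2) = psubst w g1 + psubst w g2.
Proof. exact: (rmorphD (psubst w)). Qed.

Lemma psubstM w (g1 g2 : symfun) : psubst w (g1 * g2) = psubst w g1 * psubst w g2.
Proof. exact: (rmorphM (psubst w)). Qed.

Lemma psubst1 w : psubst w 1 = 1.
Proof. exact: (rmorph1 (psubst w)). Qed.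

Record symfun_morphism (F : symfun -> rat) : Prop := SymfunMorphism {
  sfm1 : F 1 = 1;
  sfmM : forall g1 g2 : symfun, F (g1 * g2) = F g1 * F g2;
  sfmD : forall g1 g2 : symfun, F (g1 + g2) = F g1 + F g2;
  sfmZ : forall (c : rat) (g : symfun), F (c *: g) = c * F g }.

(** An algebra morphism out of QQ[p_1, p_2, ...] is determined by the power sums. *)
Lemma symfun_morphism_ext (F G : symfun -> rat) :
  symfun_morphism F -> symfun_morphism G ->
  (forall n, F (psum n.+1) = G (psum n.+1)) -> F =1 G.
Proof.
move=> [F1 FM FD FZ] [G1 GM GD GZ] FG.
elim/symfun_ind => [|n g IH|g1 g2 I1 I2|c g IH].
- by rewrite F1 G1.
- by rewrite FM GM FG IH.
- by rewrite FD GD I1 I2.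
- by rewrite FZ GZ IH.
Qed.

(** The value at p_(i+1) = v i, read off as the constant coefficient of the
    substitution of these constants. *)
HB.lock Definition eval (v : nat -> rat) (g : symfun) : rat :=
  (psubst (fun i => (v i)%:MP) g)@_mone.

Lemma eval_morphism v : symfun_morphism (eval v).
Proof.
rewrite eval.unlock; split=> [|g1 g2|g1 g2|c g].
- by rewrite psubst1 mcoeff1 eqxx.
- by rewrite psubstM (rmorphM (mcoeff mone)).
- by rewrite psubstD mcoeffD.
- by rewrite psubstZ mcoeffZ.
Qed.

Lemma eval1 v : eval v 1 = 1. Proof. exact: sfm1 (eval_morphism v). Qed.
Lemma evalM v (g1 g2 : symfun) : eval v (g1 * g2) = eval v g1 * eval v g2.
Proof. exact: sfmM (eval_morphism v) _ _. Qed.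
Lemma evalD v (g1 g2 : symfun) : eval v (g1 + g2) = eval v g1 + eval v g2.
Proof. exact: sfmD (eval_morphism v) _ _. Qed.
Lemma evalZ v c (g : symfun) : eval v (c *: g) = c * eval v g.
Proof. exact: sfmZ (eval_morphism v) _ _. Qed.

Fact eval_is_zmod_morphism v : zmod_morphism (eval v).
Proof. by move=> g1 g2; rewrite evalD -scaleN1r evalZ mulN1r. Qed.
Fact eval_is_monoid_morphism v : monoid_morphism (eval v).
Proof. by split; [exact: eval1 | exact: evalM]. Qed.
HB.instance Definition _ v :=
  GRing.isZmodMorphism.Build symfun rat (eval v) (eval_is_zmod_morphism v).
HB.instance Definition _ v :=
  GRing.isMonoidMorphism.Build symfun rat (eval v) (eval_is_monoid_morphism v).

Lemma eval_psum v n : eval v (psum n.+1) = v n.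
Proof. by rewrite eval.unlock psubst_psum // malgCK. Qed.

Lemma eval_psubst v w : eval v \o psubst w =1 eval (eval v \o w).
Proof.
apply: symfun_morphism_ext (eval_morphism _) _ => [|n]; last first.
  by rewrite [RHS]eval_psum /= (psubst_psum _ (ltn0Sn n)).
split=> [|g1 g2|g1 g2|c g] /=.
- by rewrite psubst1 eval1.
- by rewrite psubstM evalM.
- by rewrite psubstD evalD.
- by rewrite psubstZ evalZ.
Qed.

Lemma eq_eval v w : v =1 w -> eval v =1 eval w.
Proof.
move=> vw; apply: symfun_morphism_ext; try exact: eval_morphism.
by move=> n; rewrite !eval_psum.
Qed.

(** * Power sums in terms of complete homogeneous functions *)

(** The subalgebra generated by the h_n, presented by multiplication with one h_n at
    a time. *)
Inductive hspan : symfun -> Prop :=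
| hspan1 : hspan 1
| hspanM n g : hspan g -> hspan (hsum n * g)
| hspanD g1 g2 : hspan g1 -> hspan g2 -> hspan (g1 + g2)
| hspanZ c g : hspan g -> hspan (c *: g).

Lemma hspan_mul g1 g2 : hspan g1 -> hspan g2 -> hspan (g1 * g2).
Proof.
move=> h1 h2; elim: h1 => [|n g _ IH|a b _ Ia _ Ib|c g _ IH].
- by rewrite mul1r.
- by rewrite -mulrA; apply: hspanM.
- by rewrite mulrDl; apply: hspanD.
- by rewrite -scalerAl; apply: hspanZ.
Qed.

(** Newton's identity solved for p_(n+1), the summand of largest index. *)
Lemma hspan_psum n : hspan (psum n.+1).
Proof.
elim/ltn_ind: n => n IH.
have hh k : hspan (hsum k) by rewrite -[hsum k]mulr1; apply/hspanM/hspan1.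
have := hsumS n; rewrite big_ord_recr /= subnn hsum0 mulr1 => e.
have -> : psum n.+1 = n.+1%:R *: hsum n.+1
    + (-1) *: \sum_(i < n) psum i.+1 * hsum (n - i).
  by rewrite e scaleN1r addrAC subrr add0r.
apply: hspanD; apply: hspanZ => //.
elim/big_rec: _ => [|i g _ hg]; first by rewrite -(scale0r 1); apply/hspanZ/hspan1.
by apply: hspanD => //; apply: hspan_mul => //; apply: IH.
Qed.

Lemma hspan_all g : hspan g.
Proof.
elim/symfun_ind: g => [|n g IH|g1 g2 I1 I2|c g IH].
- exact: hspan1.
- by apply: hspan_mul => //; apply: hspan_psum.
- exact: hspanD.
- exact: hspanZ.
Qed.

(** * Schur functions span *)

Definition schur_spanned (g : symfun) : Prop := exists c, schur_expansion g c.

Lemma schur_sumE (c : {malg rat[intpart]}) (E : {fset intpart}) :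
  (msupp c `<=` E)%fset ->
  \sum_(mu <- msupp c) c@_mu *: schur mu = \sum_(mu <- E) c@_mu *: schur mu.
Proof.
move=> sE; apply: big_fset_incl => // mu _ /mcoeff_outdom ->.
by rewrite scale0r.
Qed.

Lemma schur_spannedD (g1 g2 : symfun) :
  schur_spanned g1 -> schur_spanned g2 -> schur_spanned (g1 + g2).
Proof.
move=> [c1 e1] [c2 e2]; exists (c1 + c2); rewrite /schur_expansion.
pose E := (msupp c1 `|` msupp c2)%fset.
rewrite (schur_sumE (msuppD_le c1 c2)) -/E.
rewrite [LHS](congr2 +%R (etrans e1 (schur_sumE (fsubsetUl _ _ : _ `<=` E)%fset))
  (etrans e2 (schur_sumE (fsubsetUr _ _ : _ `<=` E)%fset))) -big_split.
by apply: eq_bigr => mu _; rewrite mcoeffD scalerDl.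
Qed.

Lemma schur_spannedZ (a : rat) (g : symfun) :
  schur_spanned g -> schur_spanned (a *: g).
Proof.
move=> [c e]; exists (a *: c); rewrite /schur_expansion.
rewrite (schur_sumE (msuppZ_le a c)).
rewrite [LHS](congr1 ( *:%R a) e) scaler_sumr.
by apply: eq_bigr => mu _; rewrite mcoeffZ scalerA.
Qed.

Lemma schur_spanned_schur mu : schur_spanned (schur mu).
Proof.
exists << mu >>; rewrite /schur_expansion msuppU oner_eq0 big_seq_fset1.
by rewrite mcoeffUU scale1r.
Qed.

Lemma schur_spanned0 : schur_spanned 0.
Proof.
rewrite -(scale0r (schur (IntPart (isT : is_part [::])))).
exact/schur_spannedZ/schur_spanned_schur.
Qed.

(** A position is the number of smaller positions.  With i and s i replaced by such
    counts, twice the inequality holds pair by pair: for i < j the left side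
    contributes a j, the smaller of the two values, and the right side contributes
    a i or a j. *)
Lemma rearrangement n (a : 'I_n -> nat) (s : 'S_n) :
  {homo a : i j / (i <= j)%N >-> (j <= i)%N} ->
  (\sum_i a i * i <= \sum_i a i * s i)%N.
Proof.
move=> da.
have rank (k : 'I_n) : (k = \sum_(j < n) (j < k) :> nat)%N.
  rewrite -(big_mkord xpredT (fun j => nat_of_bool (j < k)%N)).
  rewrite (big_cat_nat (n := k)) //= 1?ltnW //.
  rewrite [X in (_ + X)%N]big_nat_cond [X in (_ + X)%N]big1 => [|j]; last first.
    by rewrite andbT => /andP[kj _]; rewrite ltnNge kj.
  rewrite addn0 (eq_big_nat _ _ (F2 := fun=> 1%N)).
    by rewrite sum_nat_const_nat muln1 subn0.
  by move=> j /andP[_ ->].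
have eL : (\sum_i a i * i = \sum_i \sum_(j < n) a i * (j < i))%N.
  by apply: eq_bigr => i _; rewrite -big_distrr /= -rank.
have eR : (\sum_i a i * s i = \sum_i \sum_(j < n) a i * (s j < s i))%N.
  apply: eq_bigr => i _; rewrite -big_distrr /=; congr (_ * _)%N.
  by rewrite {1}rank (reindex_inj (@perm_inj _ s)).
rewrite -leq_double -!addnn {1}eL {1}eR.
rewrite [X in (X + _)%N]exchange_big [X in (_ <= X + _)%N]exchange_big /=.
rewrite {1}eL {1}eR -!big_split /=; apply: leq_sum => i _.
rewrite -!big_split /=; apply: leq_sum => j _.
case: (ltngtP i j) => ij; last by lia.
  have := da _ _ (ltnW ij); have : s i != s j.
    by apply/eqP => /perm_inj ji; move: ij; rewrite ji ltnn.
  rewrite -val_eqE /=; case: (ltngtP (s i) (s j)) => //; lia.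
have := da _ _ (ltnW ij); have : s i != s j.
  by apply/eqP => /perm_inj ji; move: ij; rewrite ji ltnn.
rewrite -val_eqE /=; case: (ltngtP (s i) (s j)) => //; lia.
Qed.

(** For b = a + s - id, expanding squares gives
    sum b^2 - sum a^2 = 2 sum a (s - id) + sum (s - id)^2, where the first sum is
    nonnegative by rearrangement and the second positive for s != 1. *)
Lemma shift_sum_sqr n (a b : 'I_n -> nat) (s : 'S_n) :
  {homo a : i j / (i <= j)%N >-> (j <= i)%N} ->
  (forall i, b i + i = a i + s i)%N -> s != 1%g ->
  (\sum_i a i ^ 2 < \sum_i b i ^ 2)%N.
Proof.
move=> da eb s1; have rea := rearrangement s da.
have id : (\sum_i b i ^ 2 + 2 * (\sum_i a i * i) + \sum_(i < n) 2 * (s i * i)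
   = \sum_i a i ^ 2 + 2 * (\sum_i a i * s i) + \sum_(i < n) (s i ^ 2 + i ^ 2))%N.
  rewrite !big_distrr -!big_split /=; apply: eq_bigr => i _.
  have := eb i; move: (b i) (a i) (nat_of_ord (s i)) (nat_of_ord i) => p q u w e.
  have -> : (p = q + u - w)%N by lia.
  have : (w <= q + u)%N by lia.
  nia.
suff : (\sum_(i < n) 2 * (s i * i) < \sum_(i < n) (s i ^ 2 + i ^ 2))%N by lia.
have [i si] : exists i, s i != i.
  apply/existsP; apply: contraNT s1 => /existsPn h; apply/eqP/permP => i.
  by rewrite perm1; apply/eqP/negbNE/h.
rewrite (bigD1 i) // [X in (_ < X)%N](bigD1 i) //= -addSn.
apply: leq_add; last by apply: leq_sum => j _; exact: nat_Cauchy.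
by rewrite ltn_neqAle !nat_Cauchy andbT.
Qed.

Definition hprod (s : seq nat) : symfun := \prod_(a <- s) hsum a.

Lemma det_leibniz1 (R : comNzRingType) n (A : 'M[R]_n) :
  \det A = \prod_i A i i + \sum_(s : 'S_n | s != 1%g) (-1) ^+ s * \prod_i A i (s i).
Proof.
rewrite /determinant (bigD1 1%g) //= odd_perm1 expr0 mul1r; congr (_ + _).
by apply: eq_bigr => i _; rewrite perm1.
Qed.

(** The Jacobi-Trudi determinant of a family that may depend on the column: column
    operations and the removal of leading columns stay within such determinants. *)
Definition jt (R : comNzRingType) (h : nat -> nat -> R) (la : seq nat) : R :=
  \det (\matrix_(i < size la, j < size la)
    if (i <= nth 0%N la i + j)%N then h j (nth 0%N la i + j - i)%N else 0).

(** Each permutation contributes 0 or, up to sign, another product of values of h,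
    with indices b i = la_i - i + s i. *)
Lemma jt_leibniz (R : comNzRingType) (h : nat -> R) (la : seq nat) :
  exists G : 'S_(size la) -> R,
    jt (fun=> h) la = \prod_(a <- la) h a + \sum_(s | s != 1%g) G s /\
    forall s : 'S_(size la), G s = 0 \/ exists b : 'I_(size la) -> nat,
      (forall i, b i + i = nth 0%N la i + s i)%N /\
      G s = (-1) ^+ s * \prod_(a <- [seq b i | i <- enum 'I_(size la)]) h a.
Proof.
rewrite /jt; set n := size la.
pose G (s : 'S_n) : R := (-1) ^+ s * \prod_(i < n)
  (if (i <= nth 0%N la i + s i)%N then h (nth 0%N la i + s i - i)%N else 0).
exists G; split.
  rewrite det_leibniz1; congr (_ + _).
    rewrite (big_nth 0%N) big_mkord; apply: eq_bigr => i _.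
    by rewrite mxE leq_addl addnK.
  by apply: eq_bigr => s _; congr (_ * _); apply: eq_bigr => i _; rewrite mxE.
move=> s.
have [/forallP hs|/forallPn[i hi]] := boolP [forall i : 'I_n, i <= nth 0%N la i + s i]%N.
  right; exists (fun i : 'I_n => nth 0%N la i + s i - i)%N; split.
    by move=> i; rewrite subnK.
  rewrite /G big_map big_enum /=; congr (_ * _).
  by apply: eq_bigr => i _; rewrite hs.
by left; rewrite /G (bigD1 i) //= (negbTE hi) mul0r mulr0.
Qed.

Lemma mul_signE (R : nzRingType) (A : lalgType R) (b : bool) (a : A) :
  (-1) ^+ b * a = (-1) ^+ b *: a.
Proof. by rewrite mulr_sign scaler_sign. Qed.

Lemma sum_sqr_le (s : seq nat) :
  (\sum_(a <- s) a ^ 2 <= (\sum_(a <- s) a) ^ 2)%N.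
Proof.
elim: s => [|a s IH]; first by rewrite !big_nil.
by rewrite !big_cons; move: IH; set x := BIG_F; nia.
Qed.

(** Sorting, and dropping the factors h_0 = 1, makes the indices a partition. *)
Lemma hprod_sort (s : seq nat) : exists la : intpart,
  [/\ hprod s = hprod la, \sum_(a <- s) a = \sum_(a <- la) a
    & \sum_(a <- s) a ^ 2 = \sum_(a <- la) a ^ 2]%N.
Proof.
pose t := sort geq [seq a <- s | a != 0%N].
have pt : is_part t.
  rewrite /is_part sort_sorted /=; last by move=> a b; rewrite /geq /= leq_total.
  by rewrite mem_sort mem_filter eqxx.
have pm : perm_eq t [seq a <- s | a != 0%N] by rewrite perm_sort.
have eb (R : Type) (idx : R) (op : Monoid.com_law idx) (F : nat -> R) :
    F 0%N = idx -> \big[op/idx]_(a <- s) F a = \big[op/idx]_(a <- t) F a.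
  move=> F0; rewrite (perm_big _ pm) big_filter [RHS]big_mkcond.
  by apply: eq_bigr => a _; case: eqP => [->|].
exists (IntPart pt); split; last by apply: eb.
  exact: eb hsum0.
exact: (eb _ _ _ id).
Qed.

(** Induction on the gap between the square of the sum of the indices, which the
    Jacobi-Trudi expansion preserves, and the sum of their squares, which it
    increases. *)
Lemma schur_spanned_hprod (s : seq nat) : schur_spanned (hprod s).
Proof.
have [m] := ubnP ((\sum_(a <- s) a) ^ 2 - \sum_(a <- s) a ^ 2)%N.
elim: m s => // m IH s; have [la [-> -> ->]] := hprod_sort s => sm.
have [G [e hG]] := jt_leibniz hsum la.
have es : schur la = hprod la + \sum_(s | s != 1%g) G s := e.
have -> : hprod la = schur la + (-1) *: \sum_(s | s != 1%g) G s.
  by rewrite scaleN1r es; exact: (esym (addrK _ _)).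
apply: schur_spannedD (schur_spanned_schur la) _; apply: schur_spannedZ.
elim/big_rec: _ => [|sg g sg1 hg]; first exact: schur_spanned0.
apply: schur_spannedD hg.
case: (hG sg) => [->|[b [eb ->]]]; first exact: schur_spanned0.
rewrite mul_signE; apply/schur_spannedZ/IH.
have nthE F : (\sum_(a <- la) F a = \sum_(i < size la) F (nth 0%N la i))%N.
  by rewrite (big_nth 0%N) big_mkord.
have enE F : (\sum_(a <- [seq b i | i <- enum 'I_(size la)]) F a
    = \sum_(i < size la) F (b i))%N by rewrite big_map big_enum.
have e1 : (\sum_(a <- [seq b i | i <- enum 'I_(size la)]) a = \sum_(a <- la) a)%N.
  rewrite (enE id) (nthE id); apply/eqP.
  rewrite -(eqn_add2r (\sum_(i < size la) i)) -big_split /=.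
  rewrite (eq_bigr _ (fun i _ => eb i)) big_split /= eqn_add2l; apply/eqP.
  by rewrite [RHS](reindex_inj (@perm_inj _ sg)).
have e2 : (\sum_(a <- la) a ^ 2 <
    \sum_(a <- [seq b i | i <- enum 'I_(size la)]) a ^ 2)%N.
  rewrite (enE (expn^~ 2)) (nthE (expn^~ 2)); apply: shift_sum_sqr eb sg1.
  move=> i j ij; have /andP[so _] := valP la.
  apply: (sorted_leq_nth (leT := geq)) => //; rewrite ?inE //.
    by move=> x y z /= xy yz; apply: leq_trans yz xy.
  by move=> x /=.
have := sum_sqr_le [seq b i | i <- enum 'I_(size la)].
rewrite e1; move: e2 sm; move: (\sum_(a <- map _ _) _)%N (\sum_(a <- la) a ^ 2)%N => x y.
by move: ((\sum_(a <- la) a) ^ 2)%N => z; lia.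
Qed.

(** Strengthened to g times any product of h_n: a factor h_n of g then moves into
    that product. *)
Lemma schur_spanned_all (g : symfun) : schur_spanned g.
Proof.
suff h (s : seq nat) : schur_spanned (g * hprod s).
  by have := h [::]; rewrite /hprod big_nil mulr1.
elim: (hspan_all g) s => [|n g1 _ IH|g1 g2 _ I1 _ I2|c g1 _ IH] s.
- by rewrite mul1r; apply: schur_spanned_hprod.
- rewrite mulrAC mulrC; have := IH (n :: s).
  by rewrite /hprod big_cons mulrCA mulrA.
- by rewrite mulrDl; apply: schur_spannedD.
- by rewrite -scalerAl; apply: schur_spannedZ.
Qed.

Lemma schur_coefP (g : symfun) : exists c : {malg rat[intpart]},
  schur_expansion g c /\ forall mu, schur_coef mu g = c@_mu.
Proof.
exists (ClassicalEpsilon.epsilon (inhabits 0) (schur_expansion g)); split=> //.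
by apply: ClassicalEpsilon.epsilon_spec; apply: schur_spanned_all.
Qed.

(** * The specialisation at one even and two odd variables *)

(** The power sums of the alphabet with the even variable x and the odd variables
    y1, y2. *)
Definition ev (x y1 y2 : rat) : symfun -> rat :=
  eval (fun i => x ^+ i.+1 - (- y1) ^+ i.+1 - (- y2) ^+ i.+1).

(** The coefficients of (1 + y1 z)(1 + y2 z) / (1 - x z). *)
Definition superh (x y1 y2 : rat) (n : nat) : rat :=
  match n with
  | 0 => 1
  | 1 => x + y1 + y2
  | m.+2 => x ^+ m * ((x + y1) * (x + y2))
  end.

(** The part of the right-hand side of Newton's identity that comes from the
    summand z^k of p_k. *)
Definition newton_sum (x y1 y2 z : rat) (n : nat) : rat :=
  \sum_(k < n.+1) z ^+ k.+1 * superh x y1 y2 (n - k).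

Lemma newton_sumS x y1 y2 z n :
  newton_sum x y1 y2 z n.+1 = z * (superh x y1 y2 n.+1 + newton_sum x y1 y2 z n).
Proof.
rewrite /newton_sum big_ord_recl subn0 expr1 mulrDr mulr_sumr; congr (_ + _).
by apply: eq_bigr => i _; rewrite lift0 subSS mulrA -exprS.
Qed.

Lemma newton_sum0 x y1 y2 z : newton_sum x y1 y2 z 0 = z.
Proof. by rewrite /newton_sum big_ord1 /= mulr1. Qed.

Lemma newton_sum_even x y1 y2 m : newton_sum x y1 y2 x m.+1 =
  x ^+ m * (m%:R * ((x + y1) * (x + y2)) + x * (x + x + y1 + y2)).
Proof.
elim: m => [|m IH]; rewrite newton_sumS ?newton_sum0 ?IH /=; first ring.
by rewrite exprS -[m.+1]addn1 natrD; ring.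
Qed.

Lemma superhC x y1 y2 : superh x y1 y2 =1 superh x y2 y1.
Proof. by case=> [|[|n]] //=; ring. Qed.

(** The factor 1 + y1 z of the generating function cancels against the geometric
    series of ratio -y1, which is why no multiple of m appears. *)
Lemma newton_sum_odd x y1 y2 m :
  newton_sum x y1 y2 (- y1) m.+1 = - (y1 * x ^+ m * (x + y2)).
Proof.
elim: m => [|m IH]; rewrite newton_sumS ?newton_sum0 ?IH /=; first ring.
by rewrite exprS; ring.
Qed.

Lemma newton_sumC x y1 y2 z n :
  newton_sum x y1 y2 z n = newton_sum x y2 y1 z n.
Proof. by apply: eq_bigr => k _; rewrite superhC. Qed.

Lemma superh_newton x y1 y2 n : n.+1%:R * superh x y1 y2 n.+1 =
  newton_sum x y1 y2 x n - newton_sum x y1 y2 (- y1) n - newton_sum x y1 y2 (- y2) n.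
Proof.
rewrite (newton_sumC _ _ _ (- y2)).
case: n => [|m]; first by rewrite !newton_sum0 /=; ring.
rewrite newton_sum_even !newton_sum_odd /= -[m.+2]addn2 natrD; ring.
Qed.

Lemma ev_hsum x y1 y2 n : ev x y1 y2 (hsum n) = superh x y1 y2 n.
Proof.
elim/ltn_ind: n => -[|n] IH; first by rewrite hsum0 /ev eval1.
apply: (@mulfI _ n.+1%:R); first by rewrite pnatr_eq0.
rewrite /ev -evalZ hsumS superh_newton /newton_sum -!sumrB.
have evs (r : seq 'I_n.+1) F : ev x y1 y2 (\sum_(k <- r) F k)
    = \sum_(k <- r) ev x y1 y2 (F k).
  elim: r => [|k r IHr]; last by rewrite !big_cons /ev evalD -!/(ev _ _ _) IHr.
  by rewrite !big_nil /ev -(scale0r (1 : symfun)) evalZ mul0r.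
rewrite -/(ev x y1 y2) evs; apply: eq_bigr => k _.
rewrite /ev evalM eval_psum -/(ev x y1 y2) IH ?ltnS ?leq_subr //.
by rewrite !mulrBl.
Qed.

(** * Reductions of Jacobi-Trudi determinants *)

Lemma jt_nil (R : comNzRingType) (h : nat -> nat -> R) : jt h [::] = 1.
Proof. exact: det_mx00. Qed.

Lemma eq_jt (R : comNzRingType) (h h' : nat -> nat -> R) la :
  (forall j m, h j m = h' j m) -> jt h la = jt h' la.
Proof.
by move=> e; congr (\det _); apply/matrixP => i j; rewrite !mxE e.
Qed.

(** The first row is zero after its first entry. *)
Lemma jt_cons (R : comNzRingType) (h : nat -> nat -> R) a la :
  (forall j, h j.+1 (a + j.+1)%N = 0) ->
  jt h (a :: la) = h 0%N a * jt (fun j => h j.+1) la.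
Proof.
move=> h0; rewrite /jt /= (expand_det_row _ ord0) big_ord_recl /= big1 => [|j _].
  rewrite addr0 !mxE /= addn0 subn0; congr (_ * _).
  rewrite /cofactor addn0 expr0 mul1r; congr (\det _).
  by apply/matrixP => i j; rewrite !mxE /= /bump /= !add1n addnS ltnS subSS.
by rewrite !mxE /= subn0 /bump /= add1n h0 mul0r.
Qed.

(** A determinant with one nonzero diagonal above the main one: expansion along the
    first row and then along the first column. *)
Lemma jt_ones (R : comNzRingType) (h : nat -> nat -> R) n :
  (forall j, h j.+2 j.+3 = 0) ->
  jt h (nseq n.+2 1%N) = h 0%N 1%N * jt (fun j => h j.+1) (nseq n.+1 1%N)
    - h 1%N 2%N * h 0%N 0%N * jt (fun j => h j.+2) (nseq n 1%N).
Proof.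
move=> h0; rewrite {1}/jt (expand_det_row _ ord0) 2!big_ord_recl /= big1 => [|j _].
  rewrite addr0 !mxE /= addn0 subn0; congr (_ * _ + _).
    rewrite /cofactor addn0 expr0 mul1r; congr (\det _).
    by apply/matrixP => i j; rewrite !mxE /= /bump /= !add1n addnS ltnS subSS.
  rewrite /bump /= !addn0 !add1n subn0 -mulrA -mulrN; congr (_ * _).
  rewrite /cofactor /= /bump /= !addn0 add0n expr1 mulN1r; congr (- _).
  rewrite (expand_det_col _ ord0) big_ord_recl /= big1 => [|i _].
    rewrite addr0 !mxE /= subnn; congr (_ * _).
    rewrite /cofactor addn0 expr0 mul1r; congr (\det _).
    apply/matrixP => i j; rewrite !mxE /= /bump /= !add1n.
    by rewrite !addnS !ltnS !subSS.
  rewrite !mxE /= /bump /= !add1n addn0 nth_nseq.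
  by rewrite ifF ?mul0r // addn0; case: ifP.
by rewrite !mxE /= /bump /= !add1n subn0 h0 mul0r.
Qed.

(** Subtract x times each column from the next one.  On generating functions this
    multiplies by 1 - x z, so that all columns but the first see only e. *)
Lemma jt_column_op (R : comNzRingType) (x : R) (h e : nat -> R) la :
  h 0%N = e 0%N -> (forall m, h m.+1 = x * h m + e m.+1) ->
  jt (fun=> h) la = jt (fun j => if j is 0 then h else e) la.
Proof.
move=> h0 hS; rewrite /jt; set n := size la.
set A := (X in \det X = _); set B := (X in _ = \det X).
(* Right multiplication by U performs the operation. *)
pose U : 'M[R]_n := \matrix_(i, j) ((i == j)%:R - x *+ (i.+1 == j :> nat)).
have dU : \det U = 1.
  rewrite -det_tr det_trig.
    by rewrite big1 // => i _; rewrite !mxE eqxx eqn_leq ltnn subr0.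
  apply/is_trig_mxP => i j ij; rewrite !mxE.
  have -> : (j == i) = false by apply/negbTE; rewrite -val_eqE /= neq_ltn ij orbT.
  have -> : (j.+1 == i) = false by apply/negbTE; rewrite neq_ltn ltnS (ltnW ij) orbT.
  by rewrite !mulr0n subr0.
suff -> : B = A *m U by rewrite det_mulmx dU mulr1.
apply/matrixP => i j; rewrite mxE [RHS]mxE.
under eq_bigr => k _ do rewrite [U _ _]mxE mulrBr.
rewrite sumrB (bigD1 j) //= eqxx mulr1 big1 ?addr0 => [|k /negbTE ->]; last first.
  by rewrite mulr0.
case: j => -[|j] hj /=.
  rewrite big1 ?subr0 => [|k _]; last by rewrite mulr0n mulr0.
  by rewrite mxE.
rewrite (bigD1 (Ordinal (ltnW hj))) //= eqxx mulr1n big1 ?addr0 => [|k kj].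
  rewrite !mxE /=; set l := nth 0%N la i; rewrite addnS.
  case: (ltngtP i (l + j).+1) => [il|il|il].
  - rewrite -ltnS il subSn // hS; ring.
  - by rewrite leqNgt ltnW // mul0r subrr.
  - by rewrite il subnn h0 ltnn mul0r subr0.
rewrite eqSS; case: eqP => [e1|_]; last by rewrite mulr0n mulr0.
by case/eqP: kj; apply: val_inj.
Qed.

Lemma rmorph_jt (R S : comNzRingType) (F : {rmorphism R -> S}) h la :
  F (jt h la) = jt (fun j m => F (h j m)) la.
Proof.
rewrite /jt -det_map_mx; congr (\det _); apply/matrixP => i j; rewrite !mxE.
by case: ifP => // _; rewrite rmorph0.
Qed.

Lemma jt_singleton (R : comNzRingType) (h : nat -> nat -> R) a :
  jt h [:: a] = h 0%N a.
Proof. by rewrite /jt det_mx11 mxE /= addn0 subn0. Qed.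

Lemma ev_schur_jt x y1 y2 mu :
  ev x y1 y2 (schur mu) = jt (fun=> superh x y1 y2) mu.
Proof.
rewrite -(eq_jt _ (fun _ => ev_hsum x y1 y2)).
exact: (rmorph_jt (eval _) (fun=> hsum)).
Qed.

(** * Specialised Schur functions *)

(** h_n(y1, y2). *)
Fixpoint complete2 (y1 y2 : rat) (n : nat) : rat :=
  if n is m.+1 then y1 * complete2 y1 y2 m + y2 ^+ n else 1.

(** e_n(y1, y2). *)
Definition elem2 (y1 y2 : rat) (n : nat) : rat :=
  match n with 0 => 1 | 1 => y1 + y2 | 2 => y1 * y2 | _ => 0 end.

(** The recurrence of h_n(y1, y2), with characteristic roots y1 and y2. *)
Lemma complete2_rec y1 y2 n : complete2 y1 y2 n.+2 =
  (y1 + y2) * complete2 y1 y2 n.+1 - y1 * y2 * complete2 y1 y2 n.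
Proof. by rewrite /= [y2 ^+ n.+2]exprS; ring. Qed.

Lemma jt_elem2_ones y1 y2 n :
  jt (fun=> elem2 y1 y2) (nseq n 1%N) = complete2 y1 y2 n.
Proof.
elim/ltn_ind: n => -[|[|n]] IH.
- exact: jt_nil.
- by rewrite jt_singleton /= mulr1 expr1.
- by rewrite jt_ones // !IH // complete2_rec /= mulr1.
Qed.

(** The dual Jacobi-Trudi formula for the conjugate partition, which has at most
    two parts. *)
Lemma jt_elem2_hook y1 y2 b c :
  jt (fun=> elem2 y1 y2) (nseq b 2%N ++ nseq c 1%N)
    = (y1 * y2) ^+ b * complete2 y1 y2 c.
Proof.
elim: b => [|b IH] /=; first by rewrite mul1r jt_elem2_ones.
by rewrite jt_cons //= IH exprS mulrA.
Qed.

Lemma jt_elem2_large y1 y2 a la :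
  (2 < a)%N -> jt (fun=> elem2 y1 y2) (a :: la) = 0.
Proof.
case: a => [|[|[|a]]] // _.
by rewrite jt_cons /= ?mul0r // => j; rewrite addnS.
Qed.

Lemma superh_elem2 x y1 y2 m :
  superh x y1 y2 m.+1 = x * superh x y1 y2 m + elem2 y1 y2 m.+1.
Proof. by case: m => [|[|m]] /=; rewrite ?exprS; ring. Qed.

Lemma jt_superh x y1 y2 la : jt (fun=> superh x y1 y2) la =
  jt (fun j => if j is 0 then superh x y1 y2 else elem2 y1 y2) la.
Proof. exact: jt_column_op (superh_elem2 x y1 y2). Qed.

Definition column_val (x y1 y2 : rat) (n : nat) : rat :=
  if n is m.+1 then complete2 y1 y2 n + x * complete2 y1 y2 m else 1.

Lemma jt_superh_column x y1 y2 n :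
  jt (fun=> superh x y1 y2) (nseq n 1%N) = column_val x y1 y2 n.
Proof.
case: n => [|[|n]]; first exact: jt_nil.
  by rewrite jt_singleton /=; ring.
rewrite jt_superh jt_ones // !jt_elem2_ones /column_val complete2_rec /=.
by ring.
Qed.

(** After the column operation, a first row of length at least 2 meets only
    e_n(y1, y2) with n > 2 beyond its first entry. *)
Lemma jt_superh_row x y1 y2 a la :
  jt (fun=> superh x y1 y2) (a.+2 :: la) =
  x ^+ a * ((x + y1) * (x + y2)) * jt (fun=> elem2 y1 y2) la.
Proof. by rewrite jt_superh jt_cons // => j; rewrite !addSn addnS. Qed.

Definition twos (mu : seq nat) : nat := count_mem 2%N (behead mu).
Definition ones (mu : seq nat) : nat := count_mem 1%N (behead mu).
(** Hook+column partitions with first part at least 2, the only ones on which a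
    flip can be defined. *)
Definition long_hook (mu : seq nat) : bool :=
  (1 < head 0%N mu)%N && all (leq^~ 2%N) (behead mu).

Lemma is_part_cons a s : is_part (a :: s) ->
  [/\ (0 < a)%N, all (geq a) s & is_part s].
Proof.
rewrite /is_part inE negb_or /= => /and3P[p a0 ->].
have tr : transitive geq by move=> x y z /= xy yz; apply: leq_trans yz xy.
rewrite lt0n eq_sym a0 (order_path_min tr p) andbT; split=> //.
exact: path_sorted p.
Qed.

Lemma part_ones s : is_part s -> all (leq^~ 1%N) s -> s = nseq (size s) 1%N.
Proof.
elim: s => //= a s IH /is_part_cons[a0 _ ps] /andP[a1 s1].
by rewrite -IH //; case: a a0 a1 => [|[|]].
Qed.

Lemma part_twos_ones s : is_part s -> all (leq^~ 2%N) s ->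
  s = nseq (count_mem 2%N s) 2%N ++ nseq (count_mem 1%N s) 1%N.
Proof.
elim: s => //= a s IH /is_part_cons[a0 sa ps] /andP[a2 s2].
case: a a0 a2 sa => [|[|[|]]] //= _ _ sa; last by rewrite -IH.
have e := part_ones ps sa.
have c2 : count_mem 2%N s = 0%N by rewrite e count_nseq.
have c1 : count_mem 1%N s = size s by rewrite {1}e count_nseq mul1n.
by rewrite c2 c1 /= -e.
Qed.

Lemma ev_schur x y1 y2 (mu : intpart) : ev x y1 y2 (schur mu) =
  if (1 < head 0%N mu)%N then
    (if long_hook mu then x ^+ (head 0%N mu - 2) * ((x + y1) * (x + y2)) *
        ((y1 * y2) ^+ twos mu * complete2 y1 y2 (ones mu)) else 0)
  else column_val x y1 y2 (size mu).
Proof.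
rewrite ev_schur_jt /long_hook /twos /ones.
case: mu => s /= ps; case: ifP => [|/negbT].
  case: s ps => [|[|[|a]] la] //= /is_part_cons[_ dla pla] _.
  rewrite jt_superh_row subSS subSS subn0; case: ifP => [la2|].
    by rewrite {1}(part_twos_ones pla la2) jt_elem2_hook.
  move=> la2; rewrite (_ : jt _ la = 0) ?mulr0 //.
  case: la la2 {dla} pla => [|b la] //= /negbT hb /is_part_cons[_ dla _].
  apply: jt_elem2_large; rewrite ltnNge; apply: contra hb => b2.
  by rewrite b2; apply: sub_all dla => c /= cb; apply: leq_trans cb b2.
rewrite -leqNgt => h1; have e : s = nseq (size s) 1%N.
  apply: (part_ones ps); case: s ps h1 => //= a s /is_part_cons[_ sa _] a1.
  by rewrite a1; apply: sub_all sa => c /= ca; apply: leq_trans ca a1.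
by rewrite {1}e jt_superh_column.
Qed.

(** * Flip symmetry read off the specialisation *)

(** Distinct powers are linearly independent as functions on positive rationals.
    Only positive points are used, so that the factors to be cancelled below do
    not vanish. *)
Lemma powers_independent (I J : Type) (r : seq I) (P : pred I) (a : I -> rat)
    (e : I -> nat) (r' : seq J) (Q : pred J) (b : J -> rat) (f : J -> nat) :
  (forall x : rat, 0 < x ->
    \sum_(i <- r | P i) a i * x ^+ e i = \sum_(j <- r' | Q j) b j * x ^+ f j) ->
  forall k, \sum_(i <- r | P i && (e i == k)) a i =
    \sum_(j <- r' | Q j && (f j == k)) b j.
Proof.
move=> h k.
pose p := \sum_(i <- r | P i) a i *: 'X^(e i).
pose q := \sum_(j <- r' | Q j) b j *: 'X^(f j).
have hp x : p.[x] = \sum_(i <- r | P i) a i * x ^+ e i.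
  by rewrite horner_sum; apply: eq_bigr => i _; rewrite hornerZ hornerXn.
have hq x : q.[x] = \sum_(j <- r' | Q j) b j * x ^+ f j.
  by rewrite horner_sum; apply: eq_bigr => i _; rewrite hornerZ hornerXn.
have pq : p - q = 0.
  pose rs : seq rat := [seq i.+1%:R | i <- iota 0 (size (p - q))].
  apply: (@roots_geq_poly_eq0 _ _ rs); last by rewrite size_map size_iota.
    apply/allP => _ /mapP[i _ ->]; rewrite rootE hornerD hornerN hp hq.
    by rewrite h ?subrr // ltr0Sn.
  rewrite map_inj_uniq ?iota_uniq // => i j /eqP.
  by rewrite eqr_nat => /eqP[].
have : p`_k = q`_k by move/eqP: pq; rewrite subr_eq0 => /eqP ->.
rewrite !coef_sum !big_mkcondr /=.
rewrite (eq_bigr (fun i => if e i == k then a i else 0)); last first.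
  by move=> i _; rewrite coefZ coefXn eq_sym; case: eqP => _; rewrite ?mulr1 ?mulr0.
move=> ->; apply: eq_bigr => i _.
by rewrite coefZ coefXn eq_sym; case: eqP => _; rewrite ?mulr1 ?mulr0.
Qed.

Lemma complete2_scale s y1 y2 n :
  complete2 (s * y1) (s * y2) n = s ^+ n * complete2 y1 y2 n.
Proof.
elim: n => [|n IH] /=; first by rewrite mulr1.
by rewrite IH [(s * y2) ^+ _]exprMn [in RHS]exprS [s ^+ n.+1]exprS; ring.
Qed.

Lemma complete2_geom y1 y2 n :
  (y1 - y2) * complete2 y1 y2 n = y1 ^+ n.+1 - y2 ^+ n.+1.
Proof.
elim: n => [|n IH] /=; first by rewrite mulr1 !expr1.
rewrite mulrDr mulrCA IH [y1 ^+ n.+2]exprS [y2 ^+ n.+2]exprS; ring.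
Qed.

(** The geometric form of h_n(t, 1/t), times t^M to clear negative exponents.  The
    term t^(M + n + 2) identifies n, since M - n' < M + n + 2 for all n'. *)
Lemma complete2_inv t M n : t != 0 -> (n <= M)%N ->
  (t ^+ 2 - 1) * t ^+ M * complete2 t t^-1 n = t ^+ (M + n + 2) - t ^+ (M - n).
Proof.
move=> t0 nM.
have -> : (t ^+ 2 - 1) * t ^+ M * complete2 t t^-1 n =
   t ^+ M * t * ((t - t^-1) * complete2 t t^-1 n).
  by rewrite [RHS]mulrA; congr (_ * _); field.
rewrite complete2_geom mulrBr -{1}[M in X in _ - X](subnK nM).
congr (_ - _); first by rewrite -exprSr -exprD; congr (_ ^+ _); lia.
rewrite exprD -!mulrA -[RHS]mulr1; congr (_ * _).
by rewrite mulrA -exprSr -exprMn divff // expr1n.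
Qed.

Lemma long_hookP (mu : intpart) : long_hook mu ->
  parts mu = hook_col (head 0%N mu) (twos mu) (ones mu).
Proof.
case: mu => -[|a s] //= /is_part_cons[_ _ ps] /andP[_ s2].
by rewrite /hook_col /twos /ones /= -part_twos_ones.
Qed.

Lemma long_hook_inj (mu nu : intpart) : long_hook mu -> long_hook nu ->
  head 0%N mu = head 0%N nu -> twos mu = twos nu -> ones mu = ones nu -> mu = nu.
Proof.
move=> lm ln e1 e2 e3; apply: val_inj => /=.
by rewrite [LHS](long_hookP lm) [RHS](long_hookP ln) e1 e2 e3.
Qed.

Lemma hook_col_long (mu : intpart) a b c :
  parts mu = hook_col a b c -> (1 < a)%N ->
  [/\ long_hook mu, head 0%N mu = a, twos mu = b & ones mu = c].
Proof.
rewrite /long_hook /twos /ones => -> a1; rewrite /= a1 !count_cat !count_nseq.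
rewrite all_cat !all_nseq !orbT /=; split=> //.
  by rewrite mul1n mul0n addn0.
by rewrite mul1n mul0n.
Qed.

Lemma long_hook_is_hook_col (mu : intpart) : long_hook mu -> is_hook_col mu.
Proof. by move/long_hookP => e; do 3 eexists; exact: e. Qed.

Lemma column_parts (mu : intpart) :
  ~~ (1 < head 0%N mu)%N -> parts mu = nseq (size mu) 1%N.
Proof.
case: mu => s /= ps; rewrite -leqNgt => h1.
apply: (part_ones ps); case: s ps h1 => //= a s /is_part_cons[_ sa _] a1.
by rewrite a1; apply: sub_all sa => c /= ca; apply: leq_trans ca a1.
Qed.

Lemma ev_expansion x y1 y2 (g : symfun) c : schur_expansion g c ->
  ev x y1 y2 g = \sum_(mu <- msupp c) c@_mu * ev x y1 y2 (schur mu).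
Proof.
move=> ->; rewrite /ev; elim: (enum_fset (msupp c)) => [|mu s IH].
  by rewrite !big_nil -(scale0r (1 : symfun)) evalZ mul0r.
by rewrite !big_cons evalD evalZ IH.
Qed.

Lemma ev_schur_hook x y1 y2 (mu : intpart) : (1 < head 0%N mu)%N ->
  ev x y1 y2 (schur mu) = (long_hook mu)%:R * (x ^+ (head 0%N mu - 2) *
    ((x + y1) * (x + y2)) * ((y1 * y2) ^+ twos mu * complete2 y1 y2 (ones mu))).
Proof.
by move=> h; rewrite ev_schur h; case: (long_hook mu); rewrite ?mul1r ?mul0r.
Qed.

Lemma ev_hook_vanish y1 y2 (mu : intpart) : (1 < head 0%N mu)%N ->
  ev (- y1) y1 y2 (schur mu) = 0.
Proof. by move=> h; rewrite ev_schur_hook // addNr mul0r mulr0 mul0r mulr0. Qed.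

(** h_n(y1, y2) - y1 h_(n-1)(y1, y2) = y2^n. *)
Lemma ev_column y1 y2 (mu : intpart) : ~~ (1 < head 0%N mu)%N ->
  ev (- y1) y1 y2 (schur mu) = y2 ^+ size mu.
Proof.
move=> /negbTE h; rewrite ev_schur h; case: (size mu) => [|n] //=; ring.
Qed.

Lemma sum_single (T : eqType) (s : seq T) (P : pred T) (F : T -> rat) mu :
  uniq s -> mu \in s -> P mu ->
  (forall nu, nu \in s -> P nu -> nu != mu -> F nu = 0) ->
  \sum_(nu <- s | P nu) F nu = F mu.
Proof.
move=> us ms Pm h; rewrite big_mkcond (bigD1_seq mu) //= Pm.
rewrite big_seq_cond big1 ?addr0 // => nu /andP[ns nm].
by case: ifP => // Pn; apply: h.
Qed.

Section FlipOfInvariant.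
Variables (r : nat) (K : rat) (g : symfun) (c : {malg rat[intpart]}).
Hypotheses (r2 : (2 <= r)%N) (ec : schur_expansion g c).
Hypothesis inv1 : forall y1 y2 : rat, ev (- y1) y1 y2 g = K.
Hypothesis inv2 : forall x s t : rat, t != 0 ->
  s ^+ (r - 2) * (ev x (s * t) (s / t) g - K) =
  x ^+ (r - 2) * (ev s (x * t) (x / t) g - K).

(** At x = -1, y1 = 1 only columns survive, and 1^n gives y2^n; the value K accounts
    for the empty partition alone. *)
Lemma column_coef (mu : intpart) :
  ~~ (1 < head 0%N mu)%N -> parts mu != [::] -> c@_mu = 0.
Proof.
move=> hmu mu0; apply/eqP; rewrite mcoeff_eq0; apply/negP => mS.
pose d (nu : intpart) := c@_nu *+ ~~ (1 < head 0%N nu)%N.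
have h (y : rat) : 0 < y -> \sum_(nu <- msupp c | true) d nu * y ^+ size nu =
    \sum_(j <- [:: tt] | true) K * y ^+ 0%N.
  move=> _; rewrite big_seq1 expr0 mulr1 -(inv1 1 y) (ev_expansion _ _ _ ec).
  apply: eq_bigr => nu _; rewrite /d; case: (boolP (1 < _)%N) => hn.
    by rewrite ev_hook_vanish // mulr0 mul0r.
  by rewrite ev_column // mulr1n.
have := powers_independent h (size mu).
rewrite [RHS]big_pred0 => [|j]; last by move: mu0; case: (parts mu).
rewrite (sum_single (mu := mu)) ?fset_uniq //=.
  rewrite /d hmu mulr1n => /eqP; rewrite mcoeff_eq0; apply/negP.
  by rewrite negbK.
move=> nu nS /eqP sn nm; rewrite /d; case: (boolP (1 < _)%N) => // hn.
case/eqP: nm; apply: val_inj => /=.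
by rewrite (column_parts hn) (column_parts hmu) sn.
Qed.

Let c' (mu : intpart) : rat := c@_mu *+ long_hook mu.

(** The constant K is the contribution of the empty partition. *)
Lemma ev_sub_const x y1 y2 : ev x y1 y2 g - K =
  \sum_(mu <- msupp c) c' mu * (x ^+ (head 0%N mu - 2) *
    ((x + y1) * (x + y2)) * ((y1 * y2) ^+ twos mu * complete2 y1 y2 (ones mu))).
Proof.
rewrite -(inv1 0 0) !(ev_expansion _ _ _ ec) -sumrB; apply: eq_bigr => mu _.
rewrite /c'; case: (boolP (1 < head 0%N mu)%N) => hm.
  rewrite ev_hook_vanish // mulr0 subr0 ev_schur_hook //.
  by case: (long_hook mu); rewrite ?mul1r ?mul0r ?mulr0.
have -> : long_hook mu = false by rewrite /long_hook (negbTE hm).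
rewrite mul0r; have [m0|m0] := eqVneq (parts mu) [::].
  by rewrite !ev_schur (negbTE hm) m0 /= subrr.
by rewrite column_coef // !mul0r subrr.
Qed.

(** Compare coefficients of t^(M + gam + 2), then of x^p, then of s^q in the symmetry
    hypothesis.  Each side is a sum with at most one nonzero term. *)
Lemma coef_identity gam p q :
  \sum_(mu <- msupp c | (ones mu == gam) && (head 0%N mu - 2 == p)%N
      && (r - 2 + 2 * twos mu + ones mu == q)%N) c' mu =
  \sum_(mu <- msupp c | (ones mu == gam) && (r - 2 + 2 * twos mu + ones mu == p)%N
      && (head 0%N mu - 2 == q)%N) c' mu.
Proof.
apply: (powers_independent
  (P := fun mu : intpart => (ones mu == gam) && (head 0%N mu - 2 == p)%N)
  (Q := fun mu : intpart =>
    (ones mu == gam) && (r - 2 + 2 * twos mu + ones mu == p)%N)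
  (e := fun mu : intpart => (r - 2 + 2 * twos mu + ones mu)%N)
  (f := fun mu : intpart => (head 0 mu - 2)%N)) => s s0 /=.
pose L x (mu : intpart) :=
  c' mu * s ^+ (r - 2 + 2 * twos mu + ones mu) * x ^+ (head 0%N mu - 2).
pose R x (mu : intpart) :=
  c' mu * s ^+ (head 0%N mu - 2) * x ^+ (r - 2 + 2 * twos mu + ones mu).
apply: (powers_independent (P := fun mu : intpart => ones mu == gam)
  (Q := fun mu : intpart => ones mu == gam)
  (a := fun mu => c' mu * s ^+ (r - 2 + 2 * twos mu + ones mu))
  (e := fun mu : intpart => (head 0 mu - 2)%N)
  (b := fun mu => c' mu * s ^+ (head 0%N mu - 2))
  (f := fun mu : intpart => (r - 2 + 2 * twos mu + ones mu)%N)) => x x0.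
change (\sum_(i <- msupp c | ones i == gam) L x i
  = \sum_(i <- msupp c | ones i == gam) R x i).
pose M := (\max_(mu <- msupp c) ones mu)%N.
have hM mu : mu \in msupp c -> (ones mu <= M)%N.
  by move=> mS; rewrite /M (bigD1_seq mu) ?fset_uniq //= leq_maxl.
(* The hypothesis at (x, s, t), divided by its positive symmetric factor. *)
have ht (t : rat) : 0 < t ->
    \sum_(mu <- msupp c | true) (L x mu - R x mu) * complete2 t t^-1 (ones mu) = 0.
  move=> t0; have tN0 : t != 0 by rewrite gt_eqF.
  have := inv2 x s tN0; rewrite !ev_sub_const.
  have eA : (s + x * t) * (s + x / t) = (x + s * t) * (x + s / t) by field.
  rewrite eA => /eqP; rewrite -subr_eq0 !mulr_sumr -sumrB => /eqP e.
  have A0 : (x + s * t) * (x + s / t) != 0.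
    by rewrite mulf_neq0 // gt_eqF // addr_gt0 // ?mulr_gt0 // invr_gt0.
  apply: (mulfI A0); rewrite mulr0 -[RHS]e mulr_sumr; apply: eq_bigr => mu _.
  have ex (y : rat) : y ^+ (r - 2 + 2 * twos mu + ones mu)
      = y ^+ (r - 2) * (y ^+ 2) ^+ twos mu * y ^+ ones mu.
    by rewrite exprD exprD exprM.
  rewrite !complete2_scale /L /R !ex.
  have -> : s * t * (s / t) = s ^+ 2 by field.
  have -> : x * t * (x / t) = x ^+ 2 by field.
  ring.
(* Each term holds two powers of t; the higher ones determine ones mu, and no
   lower one reaches the exponent M + gam + 2. *)
have := powers_independent (P := xpredT) (Q := xpredT) (r := msupp c) (r' := msupp c)
  (a := fun mu => L x mu - R x mu) (b := fun mu => L x mu - R x mu)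
  (e := fun mu : intpart => (M + ones mu + 2)%N)
  (f := fun mu : intpart => (M - ones mu)%N).
move=> /(_ _ (M + gam + 2)%N) hk.
apply/eqP; rewrite -subr_eq0 -sumrB; apply/eqP.
rewrite (eq_bigl (fun mu : intpart =>
  true && (M + ones mu + 2 == M + gam + 2)%N)); last first.
  by move=> mu; rewrite eqn_add2r eqn_add2l.
rewrite {}hk; first by apply: big_pred0 => mu; apply/negbTE/eqP; lia.
move=> t t0; apply/eqP; rewrite -subr_eq0 -sumrB; apply/eqP.
have tN0 : t != 0 by rewrite gt_eqF.
have := congr1 ( *%R ((t ^+ 2 - 1) * t ^+ M)) (ht t t0).
rewrite mulr0 mulr_sumr; apply: etrans.
apply: eq_big_seq => mu mS; rewrite -mulrBr -complete2_inv ?hM //.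
by rewrite mulrCA.
Qed.

(** For the exponents of the term of mu, the left side of [coef_identity] is the
    coefficient of mu and the right side that of its flip. *)
Lemma flip_coef (mu : intpart) : is_hook_col mu -> c@_mu != 0 ->
  exists2 nu, flip r mu nu & c@_mu = c@_nu.
Proof.
move=> [a [b [gam e]]] cmu.
have a1 : (1 < a)%N.
  rewrite ltnNge; apply/negP => a1; case/eqP: cmu; apply: column_coef.
    by rewrite e /= -leqNgt.
  by rewrite e.
have [lm ha hb hg] := hook_col_long e a1.
have mS : mu \in msupp c by rewrite -mcoeff_neq0.
have := coef_identity gam (a - 2)%N (r - 2 + 2 * b + gam)%N.
rewrite (sum_single (mu := mu)) ?fset_uniq //; first last.
- move=> nu nS /andP[/andP[/eqP n1 /eqP n2] /eqP n3] nm; rewrite /c'.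
  case: (boolP (long_hook nu)) => // ln; case/eqP: nm.
  have /andP[hn _] := ln.
  by apply: long_hook_inj => //; lia.
- by rewrite ha hb hg !eqxx.
rewrite {1}/c' lm mulr1n => eq1.
(* The right-hand side is not zero, so some nu contributes to it. *)
have /hasP[nu nS /andP[/andP[/andP[/eqP n1 /eqP n2] /eqP n3] ln]] :
    has (fun nu : intpart => (ones nu == gam)
      && (r - 2 + 2 * twos nu + ones nu == a - 2)%N
      && (head 0 nu - 2 == r - 2 + 2 * b + gam)%N && long_hook nu) (msupp c).
  apply: contraNT cmu => /hasPn h.
  rewrite eq1 big_seq_cond big1 // => nu /andP[nS hn].
  by have := h nu nS; rewrite hn /= /c' => /negbTE ->.
have /andP[hn _] := ln.
exists nu.
  exists b, gam, (twos nu); split.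
    by rewrite e; congr hook_col; lia.
  by rewrite [LHS](long_hookP ln) n1; congr hook_col; lia.
rewrite eq1 (sum_single (mu := nu)) ?fset_uniq //.
- by rewrite /c' ln.
- by rewrite n2 n3 n1 !eqxx.
move=> nu' nS' /andP[/andP[/eqP m1 /eqP m2] /eqP m3] nm; rewrite /c'.
case: (boolP (long_hook nu')) => // ln'; case/eqP: nm.
have /andP[hn' _] := ln'.
by apply: long_hook_inj => //; lia.
Qed.
End FlipOfInvariant.

Lemma flip_symmetric_of_invariant r K (g : symfun) : (2 <= r)%N ->
  (forall y1 y2 : rat, ev (- y1) y1 y2 g = K) ->
  (forall x s t : rat, t != 0 ->
    s ^+ (r - 2) * (ev x (s * t) (s / t) g - K) =
    x ^+ (r - 2) * (ev s (x * t) (x / t) g - K)) ->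
  flip_symmetric r g.
Proof.
move=> r2 i1 i2; split=> // mu hmu; have [c [ec cE]] := schur_coefP g.
rewrite !cE => cmu; have [nu fl e] := flip_coef r2 ec i1 i2 hmu cmu.
by exists nu; rewrite ?cE.
Qed.

(** * The specialisation of a flip-symmetric function *)

(** Symmetry in x and s after division by x^(r-2), vanishing at x = -y1, and the
    parity of the degree.  The symmetry is written without division, so that x and s
    may be arbitrary; the plethysm step uses it at negative arguments. *)
Definition flip_invariant (r : nat) (g : symfun) : Prop :=
  [/\ forall y1 y2 : rat, ev (- y1) y1 y2 g = 0,
      forall x s t : rat, t != 0 ->
        s ^+ (r - 2) * ev x (s * t) (s / t) g =
        x ^+ (r - 2) * ev s (x * t) (x / t) g
    & forall x y1 y2 : rat,
        ev (- x) (- y1) (- y2) g = (-1) ^+ r * ev x y1 y2 g].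

Lemma sign_parity (a b : nat) : odd a = odd b -> (-1) ^+ a = (-1) ^+ b :> rat.
Proof. by move=> e; rewrite -signr_odd e signr_odd. Qed.

(** Reindexing along a partial involution given by its graph R, off which both
    summands vanish. *)
Lemma sum_involution (T : eqType) (s : seq T) (R : rel T) (f1 f2 : T -> rat) :
  uniq s -> symmetric R ->
  (forall x, x \in s -> (f1 x = 0 /\ f2 x = 0) \/ exists2 y, y \in s & R x y) ->
  (forall x y z, R x y -> R x z -> y = z) ->
  (forall x y, R x y -> f1 x = f2 y) ->
  \sum_(x <- s) f1 x = \sum_(x <- s) f2 x.
Proof.
move=> us Rs Rex Rf Rf12.
have one (g : T -> rat) x : x \in s -> g x = 0 \/ (exists2 y, y \in s & R x y) ->
    \sum_(y <- s | R x y) g x = g x.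
  move=> xs [g0|[y ys Rxy]]; first by rewrite big1.
  rewrite (sum_single us ys Rxy) // => z _ Rxz.
  by rewrite (Rf _ _ _ Rxz Rxy) eqxx.
rewrite (eq_big_seq (fun x => \sum_(y <- s | R x y) f2 y)); last first.
  move=> x xs; rewrite -(one f1 x xs); last by case: (Rex x xs) => [[]|]; auto.
  by apply: eq_bigr => y; apply: Rf12.
rewrite (exchange_big_dep xpredT) //=; apply: eq_big_seq => y ys.
rewrite (eq_bigl (R y)) => [|x]; last by rewrite Rs.
by apply: one => //; case: (Rex y ys) => [[]|]; auto.
Qed.

(** A column in the support would have no flip, and the empty partition is excluded
    by the constant term, so all nonzero terms come from [long_hook]s, which the flip
    pairs. *)
Lemma flip_invariant_of_flip_symmetric r (g : symfun) :
  flip_symmetric r g -> ev 0 0 0 g = 0 -> flip_invariant r g.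
Proof.
move=> [r2 fl] g0; have [c [ec cE]] := schur_coefP g.
have long mu : mu \in msupp c -> (1 < head 0%N mu)%N.
  have col nu : nu \in msupp c -> parts nu != [::] -> (1 < head 0%N nu)%N.
    move=> nS n0; apply: contraT => hn.
    have hnu : is_hook_col nu.
      exists 1%N, 0%N, (size nu).-1; rewrite (column_parts hn) size_nseq.
      by case: (parts nu) n0.
    have cn : schur_coef nu g != 0 by rewrite cE mcoeff_neq0.
    have [_ [b [d [gam [e _]]]] _] := fl nu hnu cn.
    by move: hn; rewrite e /= -leqNgt; lia.
  move=> mS; apply: contraT => hm.
  have m0 : parts mu = [::] by apply/eqP; apply: contraNT hm; exact: col.
  move: g0; rewrite (ev_expansion _ _ _ ec) (bigD1_seq mu) ?fset_uniq //=.
  rewrite big_seq_cond big1 => [|nu /andP[nS nm]].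
    rewrite addr0 ev_schur (negbTE hm) m0 mulr1 => c0.
    by move: mS; rewrite -mcoeff_neq0 c0 eqxx.
  rewrite -{1}oppr0 ev_hook_vanish ?mulr0 //; apply: col => //.
  by apply: contra nm => /eqP n0; apply/eqP/val_inj; rewrite /= n0.
have fle mu : mu \in msupp c -> long_hook mu ->
    exists nu, [/\ nu \in msupp c, long_hook nu, ones mu = ones nu, c@_mu = c@_nu
      & head 0%N mu = (r + 2 * twos nu + ones mu)%N /\
        head 0%N nu = (r + 2 * twos mu + ones mu)%N].
  move=> mS lm; have cm : schur_coef mu g != 0 by rewrite cE mcoeff_neq0.
  have [nu [b [gam [d [e1 e2]]]] e] := fl mu (long_hook_is_hook_col lm) cm.
  have h1 : (1 < r + 2 * d + gam)%N by lia.
  have h2 : (1 < r + 2 * b + gam)%N by lia.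
  have [_ p1 p2 p3] := hook_col_long e1 h1.
  have [ln q1 q2 q3] := hook_col_long e2 h2.
  exists nu; rewrite p1 p2 p3 q1 q2 q3 -!cE; split=> //.
  by rewrite -mcoeff_neq0 -cE -e.
split.
- move=> y1 y2; rewrite (ev_expansion _ _ _ ec) big_seq big1 // => mu mS.
  by rewrite ev_hook_vanish ?mulr0 //; apply: long.
- move=> x s t t0; rewrite !(ev_expansion _ _ _ ec) !mulr_sumr.
  pose R (mu nu : intpart) := [&& long_hook mu, long_hook nu,
    (ones mu == ones nu), (c@_mu == c@_nu),
    (head 0 mu == r + 2 * twos nu + ones mu)%N &
    (head 0 nu == r + 2 * twos mu + ones mu)%N].
  apply: (@sum_involution _ _ R); first exact: fset_uniq.
  + move=> mu nu; rewrite /R; apply/and5P/and5P;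
      move=> [l1 l2 /eqP e1 /eqP e2 /andP[/eqP e3 /eqP e4]];
      by rewrite l1 l2 e1 e2 e3 e4 ?e1 !eqxx.
  + move=> mu mS; have [lm|lm] := boolP (long_hook mu); last first.
      by left; rewrite !ev_schur_hook ?long // (negbTE lm) !mul0r !mulr0.
    right; have [nu [nS ln e1 e2 [e3 e4]]] := fle mu mS lm.
    by exists nu; rewrite // /R lm ln -e1 -e2 -e3 -e4 !eqxx.
  + move=> mu nu nu' /and5P[_ l1 /eqP e1 _ /andP[/eqP e3 /eqP e4]].
    move=> /and5P[_ l2 /eqP e1' _ /andP[/eqP e3' /eqP e4']].
    by apply: long_hook_inj => //; lia.
  + move=> mu nu /and5P[l1 l2 /eqP e1 /eqP e2 /andP[/eqP e3 /eqP e4]].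
    have /andP[h1 _] := l1; have /andP[h2 _] := l2.
    rewrite !ev_schur_hook // l1 l2 e2 e3 e4 !complete2_scale -e1.
    have ex (y : rat) k : y ^+ (r + 2 * k + ones mu - 2)
        = y ^+ (r - 2) * (y ^+ 2) ^+ k * y ^+ ones mu.
      by rewrite -exprM -!exprD; congr (_ ^+ _); lia.
    rewrite !ex.
    have -> : s * t * (s / t) = s ^+ 2 by field.
    have -> : x * t * (x / t) = x ^+ 2 by field.
    have -> : (s + x * t) * (s + x / t) = (x + s * t) * (x + s / t) by field.
    ring.
- move=> x y1 y2; rewrite !(ev_expansion _ _ _ ec) mulr_sumr.
  rewrite big_seq [RHS]big_seq; apply: eq_bigr => mu mS.
  rewrite !ev_schur_hook ?long //.
  have [lm|lm] := boolP (long_hook mu); last by rewrite !mul0r !mulr0.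
  have [nu [_ _ _ _ [-> _]]] := fle mu mS lm.
  rewrite -[- y1]mulN1r -[- y2]mulN1r complete2_scale -[- x]mulN1r.
  have -> : (-1 * x) ^+ (r + 2 * twos nu + ones mu - 2) =
      (-1) ^+ r * (-1) ^+ ones mu * x ^+ (r + 2 * twos nu + ones mu - 2).
    rewrite exprMn; congr (_ * _); rewrite -exprD.
    by apply: sign_parity; lia.
  have -> : -1 * y1 * (-1 * y2) = y1 * y2 by ring.
  have e1 : (-1) ^+ ones mu * (-1) ^+ ones mu = 1 :> rat.
    by rewrite -exprMn mulrNN mulr1 expr1n.
  move: e1; set u := (-1) ^+ ones mu; move=> e1.
  rewrite !mul1r !mulN1r -opprD -opprD mulrNN.
  transitivity (u * u * (c@_mu * ((-1) ^+ r *
      x ^+ (r + 2 * twos nu + ones mu - 2) * ((x + y1) * (x + y2)) *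
      ((y1 * y2) ^+ twos mu * complete2 y1 y2 (ones mu))))); first ring.
  rewrite e1; ring.
Qed.

(** * Plethysm with partitions of two *)

Lemma ev_adams n x y1 y2 (g : symfun) :
  ev x y1 y2 (adams n.+1 g) =
  eval (fun j => x ^+ (n.+1 * j.+1) - (- y1) ^+ (n.+1 * j.+1)
                 - (- y2) ^+ (n.+1 * j.+1)) g.
Proof.
rewrite /ev /adams; apply: etrans (eval_psubst _ _ _) _.
by apply: eq_eval => j; rewrite /= mulnS addSn eval_psum.
Qed.

Lemma part_of_two (la : intpart) : sumn la = 2%N ->
  parts la = [:: 2%N] \/ parts la = [:: 1%N; 1%N].
Proof.
case: la => s /= ps; case: s ps => [|a s] //= /is_part_cons[a0 _ ps] e.
case: s ps e => [|b s] /= ps e; first by left; congr [:: _]; lia.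
have [b0 _ {}ps] := is_part_cons ps.
right; case: s ps e => [|d s] /= ps e; first by congr [:: _; _]; lia.
by have [d0 _ _] := is_part_cons ps; lia.
Qed.

(** s_(2) and s_(1,1) are (p_1^2 + eps p_2) / 2 with eps = 1 and eps = -1; doubling
    n in x^n - (-y1)^n - (-y2)^n gives the same expression at
    (x^2, -y1^2, -y2^2). *)
Lemma ev_plethysm (la : intpart) : sumn la = 2%N ->
  exists eps : rat, forall (x y1 y2 : rat) (g : symfun),
    ev x y1 y2 (plethysm (schur la) g) = 2^-1 *
      (ev x y1 y2 g ^+ 2 + eps * ev (x ^+ 2) (- y1 ^+ 2) (- y2 ^+ 2) g).
Proof.
move=> /part_of_two e.
have [eps hs] : exists eps : rat, schur la = 2^-1 *: (psum 1 * psum 1 + eps *: psum 2).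
  case: e => e.
    by exists 1; rewrite (schur_2 e) (expr2 (psum 1)) (scale1r (psum 2)).
  by exists (-1); rewrite (schur_11 e) (expr2 (psum 1)) (scaleN1r (psum 2)).
exists eps => x y1 y2 g; rewrite hs.
have A1 : ev x y1 y2 (adams 1 g) = ev x y1 y2 g.
  by rewrite ev_adams; apply: eq_eval => j; rewrite mul1n.
have A2 : ev x y1 y2 (adams 2 g) = ev (x ^+ 2) (- y1 ^+ 2) (- y2 ^+ 2) g.
  by rewrite ev_adams; apply: eq_eval => j; rewrite !opprK !exprM !sqrrN.
apply: etrans (congr2 (fun a b => 2^-1 * (a ^+ 2 + eps * b)) A1 A2).
rewrite /ev /plethysm; apply: etrans (eval_psubst _ _ _) _.
by rewrite evalZ evalD evalM evalZ !eval_psum.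
Qed.

(** The term p_2 o g uses the symmetry of g at (x^2, -s^2, t^2), followed by the
    parity of g to move the sign back. *)
Lemma flip_invariant_plethysm r (la : intpart) (g : symfun) :
  (2 <= r)%N -> sumn la = 2%N -> flip_invariant r g ->
  flip_invariant (2 * r - 2) (plethysm (schur la) g).
Proof.
move=> r2 /ev_plethysm[eps E] [i1 i2 i3].
have i1' y1 y2 : ev (y1 ^+ 2) (- y1 ^+ 2) (- y2 ^+ 2) g = 0.
  by rewrite -{1}[y1 ^+ 2]opprK i1.
split=> [y1 y2|x s t t0|x y1 y2]; rewrite !E.
- by rewrite i1 sqrrN i1'; ring.
- have -> : (2 * r - 2 - 2 = (r - 2) * 2)%N by lia.
  have sq (y z w : rat) : y ^+ ((r - 2) * 2) * (2^-1 * (z ^+ 2 + eps * w)) =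
      2^-1 * ((y ^+ (r - 2) * z) ^+ 2 + eps * ((y ^+ 2) ^+ (r - 2) * w)).
    by rewrite mulnC exprM -[(y ^+ 2) ^+ _]exprM mulnC exprM; ring.
  rewrite !sq i2 //; congr (_ * (_ + _ * _)).
  have t20 : t ^+ 2 != 0 by rewrite expf_neq0.
  have := i2 (x ^+ 2) (- s ^+ 2) (t ^+ 2) t20.
  have -> : - s ^+ 2 * t ^+ 2 = - (s * t) ^+ 2 by ring.
  have -> : - s ^+ 2 / t ^+ 2 = - (s / t) ^+ 2 by field.
  have -> : x ^+ 2 * t ^+ 2 = - - (x * t) ^+ 2 by ring.
  have -> : x ^+ 2 / t ^+ 2 = - - (x / t) ^+ 2 by field.
  rewrite i3 => e.
  have sg : (-1) ^+ (r - 2) = (-1) ^+ r :> rat.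
    by apply: sign_parity; lia.
  move: e; rewrite -[- s ^+ 2]mulN1r exprMn sg => e.
  apply: (mulfI (x := (-1) ^+ r)); first by rewrite signr_eq0.
  by rewrite mulrA e; ring.
- rewrite i3 !sqrrN exprMn -exprM.
  rewrite (@sign_parity (r * 2) 0) ?(@sign_parity (2 * r - 2) 0); [|lia|lia].
  by rewrite !mul1r.
Qed.

(** * Constant terms and iterated plethysm *)

(** Both sides are algebra morphisms that kill all power sums. *)
Lemma eval0 (g : symfun) : eval (fun=> 0) g = g@_mone.
Proof.
move: g; apply: symfun_morphism_ext (eval_morphism _) _ _ => [|n].
  split=> [|g1 g2|g1 g2|c g].
  - by rewrite mcoeff1 eqxx.
  - exact: (rmorphM (mcoeff mone)).
  - exact: mcoeffD.
  - exact: mcoeffZ.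
by rewrite eval_psum psum.unlock mcoeffU cm1_eq1.
Qed.

Lemma ev000 (g : symfun) : ev 0 0 0 g = g@_mone.
Proof.
rewrite -eval0; apply: eq_eval => i.
by rewrite oppr0 expr0n /= !subr0.
Qed.

Lemma weight_eq0 (m : {cmonom nat}) : weight m = 0%N -> m = mone.
Proof.
move=> /eqP; rewrite /weight sum_nat_seq_eq0 => /allP w0.
apply/eqP/cmP => i; rewrite cm1; apply/eqP; apply: contraT.
rewrite cmE_neq0 => im; have := w0 i im; rewrite /= muln_eq0 /=.
by rewrite cmE_eq0 im.
Qed.

(** A nonzero constant term puts the degree at 0, and only the empty monomial has
    weight 0. *)
Lemma homogeneous_const (f : symfun) :
  homogeneous f -> f@_mone != 0 -> f = f@_mone *: 1.
Proof.
move=> [d hd] f0; apply/malgP => m; rewrite [RHS]mcoeffZ mcoeff1.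
have d0 : d = 0%N.
  rewrite -(hd mone); first by rewrite /weight mdom1 big_seq_fset0.
  by rewrite -mcoeff_neq0.
have [->|m1] := eqVneq m mone; first by rewrite mulr1.
rewrite mulr0; apply/eqP; rewrite mcoeff_eq0; apply: contra m1 => mS.
by apply/eqP/weight_eq0; rewrite (hd m mS).
Qed.

Section Iteration.
Variables (f : symfun) (r : nat).
Hypothesis r2 : (2 <= r)%N.
Let iter (s : seq intpart) := foldr (fun la g => plethysm (schur la) g) f s.

Lemma flip_invariant_iter s : all (fun la : intpart => sumn la == 2%N) s ->
  flip_invariant r f ->
  flip_invariant (2 ^ size s * r - 2 ^ (size s).+1 + 2) (iter s).
Proof.
move=> hs hf; elim: s hs => [|la s IH] /=.
  by rewrite expn0 mul1n expn1 subnK.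
move=> /andP[/eqP e hs]; have {}IH := IH hs.
have := flip_invariant_plethysm _ e IH; rewrite -/(iter s).
have h : (2 ^ (size s).+1 <= 2 ^ size s * r)%N.
  by rewrite expnSr leq_mul2l r2 orbT.
have -> : (2 * (2 ^ size s * r - 2 ^ (size s).+1 + 2) - 2 =
   2 ^ (size s).+1 * r - 2 ^ (size s).+2 + 2)%N.
  by move: h; rewrite !expnS; nia.
by apply; lia.
Qed.

Lemma const_iter s : all (fun la : intpart => sumn la == 2%N) s ->
  (exists K, forall x y1 y2, ev x y1 y2 f = K) ->
  exists K, forall x y1 y2, ev x y1 y2 (iter s) = K.
Proof.
move=> hs hf; elim: s hs => [|la s IH] //= /andP[/eqP /ev_plethysm[eps E] hs].
have [K hK] := IH hs; exists (2^-1 * (K ^+ 2 + eps * K)) => x y1 y2.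
by rewrite -/(iter s) E !hK.
Qed.
End Iteration.
Local Close Scope ring_scope.

Theorem mainTheorem6 (f : symfun) (r k : nat) (lam : k.-tuple intpart) :
  schur_positive f -> homogeneous f ->
  (forall i : 'I_k, sumn (tnth lam i) = 2) ->
  flip_symmetric r f ->
  flip_symmetric (2 ^ k * r - 2 ^ k.+1 + 2)
    (foldr (fun la g => plethysm (schur la) g) f lam).
Proof.
move=> _ hom hlam fl; have [r2 _] := fl.
have hs : all (fun la : intpart => sumn la == 2) lam.
  by apply/allP => la /tnthP[i ->]; rewrite hlam.
have ge2 : 2 <= 2 ^ k * r - 2 ^ k.+1 + 2 by rewrite addnC leq_addr.
have [f0|f0] := eqVneq (f@_mone) 0%R.
  have := flip_invariant_of_flip_symmetric fl (etrans (ev000 f) f0).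
  move=> /(flip_invariant_iter r2 hs); rewrite size_tuple => -[i1 i2 _].
  apply: (flip_symmetric_of_invariant (K := 0%R)) => // x s t t0.
  by rewrite !subr0 i2.
have [K hK] : exists K, forall x y1 y2,
    ev x y1 y2 (foldr (fun la g => plethysm (schur la) g) f lam) = K.
  apply: (const_iter hs); exists (f@_mone) => x y1 y2.
  by rewrite {1}(homogeneous_const hom f0) /ev evalZ eval1 mulr1.
apply: (flip_symmetric_of_invariant (K := K)) => // x s t _.
by rewrite !hK subrr !mulr0.
Qed.
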